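(* Let $f:2^V\to\mathbb{R}_{\ge 0}$ be a monotone, normalized submodular function and let $\mathcal{M}\subseteq 2^V$ be a matroid. For any (possibly adaptive) stream of elements of $V$, the algorithm \textsc{Swapping} described below outputs a set $S\in\mathcal{M}$ with $f(O)\le 4\, f(S)$ deterministically, where $O$ is an independent set of maximum $f$-value among all independent subsets of the elements that appeared in the stream.
   Context: Notation: $f(X\mid Y)=f(X\cup Y)-f(Y)$, $f(x\mid Y)=f(\{x\}\mid Y)$; $X+e=X\cup\{e\}$, $X-e=X\setminus\{e\}$. $f$ is monotone ($f(e\mid X)\ge 0$), submodular ($f(e\mid X)\ge f(e\mid Y)$ for $X\subseteq Y$, $e\notin Y$) and normalized ($f(\emptyset)=0$). A set is independent if it belongs to $\mathcal{M}$. Algorithm \textsc{Swapping}: initialize $S\gets\emptyset$, $S'\gets\emptyset$. For each arriving element $e$: set $w(e)\gets f(e\mid S')$ (this weight is fixed forever). If $S+e\in\mathcal{M}$, set $S\gets S+e$ and $S'\gets S'+e$. Otherwise let $s_e\in\arg\min\{w(y): y\in S,\ S-y+e\in\mathcal{M}\}$ (ties broken in any consistent way); if $2w(s_e)<w(e)$, set $S\gets S-s_e+e$ and $S'\gets S'+e$. At the end, return $S$. *)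

(* Defs.v *)
From HB Require Import structures.
From mathcomp Require Import all_boot all_order all_algebra.

Set Implicit Arguments.
Unset Strict Implicit.
Unset Printing Implicit Defensive.

Import Order.TTheory GRing.Theory Num.Theory.
Local Open Scope ring_scope.

Section Definitions.

Variables (R : realFieldType) (V : finType).

Definition marginal (f : {set V} -> R) (X Y : {set V}) : R := f (X :|: Y) - f Y.

Definition nonnegative (f : {set V} -> R) : Prop := forall X, 0 <= f X.

Definition monotone (f : {set V} -> R) : Prop :=
  forall (e : V) (X : {set V}), 0 <= marginal f [set e] X.

Definition submodular (f : {set V} -> R) : Prop :=
  forall (X Y : {set V}) (e : V), X \subset Y -> e \notin Y ->
    marginal f [set e] Y <= marginal f [set e] X.

Definition normalized (f : {set V} -> R) : Prop := f set0 = 0.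

(* M is the family of independent sets. *)
Definition matroid (M : {set {set V}}) : Prop :=
  [/\ set0 \in M,
      (forall A B : {set V}, A \subset B -> B \in M -> A \in M) &
      (forall A B : {set V}, A \in M -> B \in M -> (#|A| < #|B|)%N ->
         exists2 x, x \in B :\: A & x |: A \in M)].

(* [cur] is the set S, [added] the set S' of all elements ever taken into S.   *)
(* [seen] records the elements that already have a weight; the values of       *)
(* [weight] outside [seen] are irrelevant.                                     *)
Record state := State {
  cur : {set V};
  added : {set V};
  seen : {set V};
  weight : {ffun V -> R}
}.

Definition init_state : state := State set0 set0 set0 [ffun=> 0].

(* "This weight is fixed forever": if e occurs again later in the stream, it   *)
(* keeps the weight of its first arrival.                                      *)
Definition set_weight (f : {set V} -> R) (st : state) (e : V) : state :=
  if e \in seen st then st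
  else State (cur st) (added st) (e |: seen st)
    [ffun x => if x == e then marginal f [set e] (added st) else weight st x].

Definition exchangeable (M : {set {set V}}) (st : state) (e : V) : {set V} :=
  [set y in cur st | e |: (cur st :\ y) \in M].

Definition argmin_exchange (M : {set {set V}}) (st : state) (e : V) : {set V} :=
  [set y in exchangeable M st e |
    [forall z in exchangeable M st e, weight st y <= weight st z]].

(* A rule s choosing the element s_e, with ties resolved as an arbitrary       *)
(* function of the arriving element and of the whole state.                    *)
Definition tie_breaking (M : {set {set V}}) (s : state -> V -> V) : Prop :=
  forall st e, argmin_exchange M st e != set0 -> s st e \in argmin_exchange M st e.

(* If e is a loop, no exchange is possible, s_e is undefined and e is          *)
(* discarded: this is the test [argmin_exchange M st1 e != set0].              *)
Definition swapping_step (f : {set V} -> R) (M : {set {set V}})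
    (s : state -> V -> V) (st : state) (e : V) : state :=
  let st1 := set_weight f st e in
  let w := weight st1 in
  if e |: cur st1 \in M
  then State (e |: cur st1) (e |: added st1) (seen st1) w
  else
    let se := s st1 e in
    if (argmin_exchange M st1 e != set0) && (2 * w se < w e)
    then State (e |: (cur st1 :\ se)) (e |: added st1) (seen st1) w
    else st1.

(* The transcript lists every arrived element with the state reached just      *)
(* after it was processed.                                                     *)
Definition transcript := seq (V * state).

Definition final_state (h : transcript) : state := last init_state (unzip2 h).

Definition arrived (h : transcript) : {set V} := [set x in unzip1 h].

(* An adaptive stream selects the next element from the transcript so far,     *)
(* [None] meaning that the stream is over.                                     *)
Definition adaptive_stream := transcript -> option V.

Fixpoint swapping (f : {set V} -> R) (M : {set {set V}}) (s : state -> V -> V)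
    (adv : adaptive_stream) (n : nat) : transcript :=
  if n is m.+1 then
    let h := swapping f M s adv m in
    if adv h is Some e then
      rcons h (e, swapping_step f M s (final_state h) e)
    else h
  else [::].

Definition max_independent (f : {set V} -> R) (M : {set {set V}})
    (E O : {set V}) : Prop :=
  [/\ O \in M, O \subset E &
      forall A : {set V}, A \in M -> A \subset E -> f A <= f O].

End Definitions.

(* Main.v *)
(** Call [e] spanned by the independent set [A] if [e] lies in [A] or [e |: A]
    is dependent.  The central invariant is that every element [e] that has a
    weight is spanned by those [y] in the current solution [S] with
    [w e <= 2 * w y]: a rejected element satisfies it by the choice of [s_e],
    and a swap replaces the lightest element of a circuit by a heavier element
    of the same circuit, so it does not shrink the span of the part of [S]
    above a threshold.  In particular an element that returns later in the
    stream changes nothing.  By the augmentation axiom, any independent set of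
    seen elements has at most as many elements of weight at least [t] as [S]
    has elements [y] with [t <= 2 * w y], for every [t], so that
    [w(O) <= 2 * w(S)].
    The discarded elements weigh at most [w(S)], since each of them is dominated
    by the gain of the swap that removes it.  As [w] telescopes to [f] on the set
    [S'] of all added elements, [f(S') = w(S') <= 2 * w(S)], whence
    [f(O) <= f(S') + w(O) <= 4 * w(S) <= 4 * f(S)]. *)

Require Import Defs.
From HB Require Import structures.
From mathcomp Require Import all_boot all_order all_algebra.
From mathcomp Require Import lra.
Import Order.TTheory GRing.Theory Num.Theory.
Local Open Scope ring_scope.

(** * Spanning and exchange in a matroid *)

Section Matroid.

Set Implicit Arguments.

Context {V : finType} {M : {set {set V}}}.
Implicit Types (A B S : {set V}) (e x y : V).

Definition spanned (M : {set {set V}}) (A : {set V}) (e : V) : bool :=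
  (e \in A) || (e |: A \notin M).

Lemma spannedS A B e : matroid M ->
  A \subset B -> spanned M A e -> spanned M B e.
Proof.
move=> [_ Mdown _] sAB /orP[eA | nMA]; rewrite /spanned.
  by rewrite (subsetP sAB).
apply/orP; right; apply: contra nMA; apply: Mdown.
exact: setUS.
Qed.

Lemma card_spanned A B : matroid M -> A \in M -> B \in M ->
  (forall x, x \in B -> spanned M A x) -> (#|B| <= #|A|)%N.
Proof.
move=> [_ _ Maug] MA MB spAB; rewrite leqNgt; apply/negP => ltAB.
have [x /setDP[xB xnA] MxA] := Maug A B MA MB ltAB.
by have := spAB x xB; rewrite /spanned (negPf xnA) MxA.
Qed.

(** Otherwise [x |: B] would be independent, spanned by [A] and larger than [A]. This serves the
    swap, where [B] arises from [A] by replacing one element. *)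
Lemma spanned_trans A B x : matroid M -> A \in M -> (#|A| <= #|B|)%N ->
  (forall y, y \in B -> spanned M A y) -> spanned M A x -> spanned M B x.
Proof.
move=> mM MA leAB spAB spAx; rewrite /spanned.
have [//|xnB /=] := boolP (x \in B).
apply/negP => MxB.
have : (#|x |: B| <= #|A|)%N.
  apply: (card_spanned mM MA MxB) => y.
  by case/setU1P => [-> //|]; apply: spAB.
by rewrite cardsU1 xnB add1n ltnNge leAB.
Qed.

(** Extend [e |: A] to a maximal independent subset [B] of [e |: S]. It has at least [#|S|] elements
    and misses some [y] of [S], so by cardinality it equals [e |: (S :\ y)]; and [y] avoids [A]
    because [B] contains [A]. *)
Lemma extend_exchange S A e : matroid M -> S \in M -> e |: S \notin M ->
  A \subset S -> e |: A \in M ->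
  exists2 y, y \in S :\: A & e |: (S :\ y) \in M.
Proof.
move=> mM MS nMeS sAS MeA.
have [_ Mdown Maug] := mM.
pose P := [pred B : {set V} | (B \in M) && (B \subset e |: S)].
have P0 : P (e |: A) by rewrite /= MeA setUS.
have [B /maxsetP[/andP[MB sBeS] maxB] seAB] := maxset_exists P0.
have leSB : (#|S| <= #|B|)%N.
  rewrite leqNgt; apply/negP => ltBS.
  have [z /setDP[zS znB] MzB] := Maug B S MB MS ltBS.
  have : z |: B = B.
    apply: maxB; last exact: subsetUr.
    by rewrite /= MzB subUset sub1set sBeS !inE zS orbT.
  by move=> zB; move: znB; rewrite -zB setU11.
have eB : e \in B by apply: (subsetP seAB); rewrite setU11.
have neBeS : ~~ (e |: S \subset B).
  by apply: contra nMeS => sSB; apply: Mdown MB.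
have [y yeS ynB] := subsetPn neBeS.
have yS : y \in S.
  by case/setU1P: yeS => // ye; move: ynB; rewrite ye eB.
have ynA : y \notin A.
  by apply: contra ynB => yA; apply: (subsetP seAB); rewrite setU1r.
exists y; first by rewrite inE ynA.
have sBy : B \subset e |: (S :\ y).
  apply/subsetP => z zB; have := subsetP sBeS z zB.
  rewrite !inE; case: eqP => //= _ ->; rewrite andbT.
  by apply: contraNneq ynB => <-.
have /eqP <- // : B == e |: (S :\ y).
rewrite eqEcard sBy /= (leq_trans _ leSB) // (cardsD1 y S) yS.
by rewrite cardsU1 leq_add2r leq_b1.
Qed.

End Matroid.

(** * Comparing sums through superlevel counts *)

Section Sums.

Set Implicit Arguments.

Context {R : realFieldType} {V : finType}.

(** Match a largest [b] of [B] with some [a] such that [v b <= u a], remove both and induct. For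
    [t <= v b] both counts drop by one; for larger [t] the count on [B] is zero. *)
Lemma ler_sum_of_card_superlevel (A B : {set V}) (u v : V -> R) :
  (forall a, a \in A -> 0 <= u a) ->
  (forall t, (#|[set b in B | (t <= v b)%R]| <= #|[set a in A | (t <= u a)%R]|)%N) ->
  \sum_(b in B) v b <= \sum_(a in A) u a.
Proof.
have [k leBk] := ubnP #|B|; elim: k A B leBk => // k IHk A B leBk u0 cardAB.
have [->|[b0 b0B]] := set_0Vmem B.
  by rewrite big_set0; apply: sumr_ge0.
have [b bB maxb] : exists2 b, b \in B & {in B, forall c, v c <= v b}.
  by case: (arg_maxP v b0B) => b bB maxb; exists b.
have [a /setIdP[aA leba]] : exists a, a \in [set a in A | v b <= u a].
  apply/card_gt0P; apply: leq_trans (cardAB (v b)).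
  by apply/card_gt0P; exists b; rewrite inE bB lexx.
rewrite (big_setD1 _ bB) (big_setD1 _ aA) /=; apply: lerD => //.
apply: IHk => [|c /setD1P[_]|t].
- by move: leBk; rewrite (cardsD1 b) bB.
- exact: u0.
have [letb|ltbt] := leP t (v b); last first.
  rewrite (_ : [set _ in _ | _] = set0) ?cards0 //.
  apply/setP => c; rewrite !inE; apply/negP => /andP[/andP[_ cB]].
  by rewrite leNgt (le_lt_trans (maxb c cB) ltbt).
have := cardAB t.
rewrite (cardsD1 b) (cardsD1 a [set a in A | _]) !inE bB aA letb.
rewrite (le_trans letb leba) leq_add2l.
have E (C : {set V}) (w : V -> R) c :
    [set x in C | t <= w x] :\ c = [set x in C :\ c | t <= w x].
  by apply/setP => x; rewrite !inE andbA.
by rewrite !E.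
Qed.

End Sums.

(** * Marginals of monotone submodular functions *)

Section Submodular.

Set Implicit Arguments.

Context {R : realFieldType} {V : finType} {f : {set V} -> R}.
Implicit Types (A B X : {set V}) (e : V).

Lemma set_add_ind (P : {set V} -> Prop) :
  P set0 -> (forall e A, e \notin A -> P A -> P (e |: A)) -> forall A, P A.
Proof.
move=> P0 PU A; have [k] := ubnP #|A|; elim: k A => // k IHk A leAk.
have [-> //|[e eA]] := set_0Vmem A.
rewrite -(setD1K eA); apply: PU; first by rewrite setD11.
by apply: IHk; move: leAk; rewrite (cardsD1 e) eA.
Qed.

Lemma marginal_mem e X : e \in X -> marginal f [set e] X = 0.
Proof. by move=> eX; rewrite /marginal (setUidPr _) ?subrr // sub1set. Qed.

Lemma monotone_subset A B : monotone f -> A \subset B -> f A <= f B.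
Proof.
move=> fmono /setUidPr <-; rewrite setUC.
elim/set_add_ind: B => [|e B _ IHB]; first by rewrite set0U.
apply: le_trans IHB _; rewrite -setUA.
by have := fmono e (B :|: A); rewrite /marginal subr_ge0.
Qed.

(** Monotonicity covers the case [e \in B], where the marginal at [B] vanishes. *)
Lemma marginal_antimono e A B : monotone f -> submodular f ->
  A \subset B -> marginal f [set e] B <= marginal f [set e] A.
Proof.
move=> fmono fsub sAB; have [eB|enB] := boolP (e \in B); last exact: fsub.
by rewrite marginal_mem //; apply: fmono.
Qed.

Lemma submodular_setU_le A B : monotone f -> submodular f ->
  f (A :|: B) <= f B + \sum_(e in A) marginal f [set e] B.
Proof.
move=> fmono fsub; elim/set_add_ind: A => [|e A enA IHA].
  by rewrite set0U big_set0 addr0.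
rewrite big_setU1 //= -setUA.
have := marginal_antimono e fmono fsub (subsetUr A B).
by rewrite {1}/marginal; move: IHA; lra.
Qed.

End Submodular.

(** * The invariant of the algorithm and the final bound *)

Section Swapping.

Set Implicit Arguments.

Context {R : realFieldType} {V : finType}.
Context {f : {set V} -> R} {M : {set {set V}}} {s : state R V -> V -> V}.
Hypotheses (fmono : monotone f) (fnorm : normalized f) (fsub : submodular f).
Hypotheses (mM : matroid M) (tieM : tie_breaking M s).
Implicit Types (st : state R V) (e x y : V) (t : R).

Definition heavy st t : {set V} := [set y in cur st | t <= 2 * weight st y].

(** [inv_marginal] bounds the marginals of the optimum by its weights, and [inv_subvalue] gives
    [w(S) <= f(S)]. The latter ranges over all subsets of [added st] so that it survives deletions
    from [S]. *)
Record swapping_inv st : Prop := SwappingInv {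
  inv_indep : cur st \in M;
  inv_cur_added : cur st \subset added st;
  inv_added_seen : added st \subset seen st;
  inv_weight_ge0 : forall e, e \in seen st -> 0 <= weight st e;
  inv_marginal : forall e, e \in seen st ->
    marginal f [set e] (added st) <= weight st e;
  inv_value : f (added st) = \sum_(e in added st) weight st e;
  inv_subvalue : forall C : {set V}, C \subset added st ->
    \sum_(e in C) weight st e <= f C;
  inv_added_weight :
    \sum_(e in added st) weight st e <= 2 * \sum_(e in cur st) weight st e;
  inv_spanned : forall e, e \in seen st ->
    spanned M (heavy st (weight st e)) e
}.

Lemma heavy_sub st t : heavy st t \subset cur st.
Proof. by apply/subsetP => y /setIdP[]. Qed.

Lemma heavy_indep st t : cur st \in M -> heavy st t \in M.
Proof. by case: mM => _ Mdown _; apply: Mdown; apply: heavy_sub. Qed.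

Lemma swapping_inv_init : swapping_inv (init_state R V).
Proof.
have [M0 _ _] := mM.
split=> //=; rewrite ?sub0set ?big_set0 ?mulr0 //.
- by move=> e; rewrite inE.
- by move=> e; rewrite inE.
- by move=> C; rewrite subset0 => /eqP ->; rewrite big_set0 fnorm.
- by move=> e; rewrite inE.
Qed.

Lemma argmin_exchange_neq0 st e y :
  y \in exchangeable M st e -> argmin_exchange M st e != set0.
Proof.
move=> yX; case: (arg_minP (weight st) yX) => z zX minz.
apply/set0Pn; exists z; rewrite inE; apply/andP; split; first exact: zX.
by apply/forallP => x; apply/implyP => /minz.
Qed.

Lemma tie_breaking_le st e y : y \in exchangeable M st e ->
  weight st (s st e) <= weight st y.
Proof.
move=> yX; have := tieM _ _ (argmin_exchange_neq0 yX).
by rewrite inE => /andP[_ /forall_inP]; apply.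
Qed.

(** Were [e |: heavy st t] independent, [extend_exchange] would give an exchangeable [y] with
    [2 * w y < t], lighter than the minimizer [s st e]. The bound on [t] is conditional because a
    loop has no exchange. *)
Lemma heavy_spanned st e t : cur st \in M -> e |: cur st \notin M ->
  (argmin_exchange M st e != set0 -> t <= 2 * weight st (s st e)) ->
  spanned M (heavy st t) e.
Proof.
move=> MS nMe lets; rewrite /spanned; apply/orP; right; apply/negP => MeA.
have [y /setDP[yS ynA] MSy] := extend_exchange mM MS nMe (heavy_sub _ _) MeA.
have yX : y \in exchangeable M st e by rewrite inE yS.
move: ynA; rewrite inE yS /= -ltNge => ltyt.
have := lets (argmin_exchange_neq0 yX); have := tie_breaking_le yX.
by move: ltyt; lra.
Qed.

(** If [e] is not in [S], its heavy set spans it. This forbids insertion, and also a swap: the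
    removed element would not be heavy, so the new solution would contain [e] and the whole heavy
    set. *)
Lemma swapping_step_seen st e : swapping_inv st -> e \in seen st ->
  swapping_step f M s st e = st.
Proof.
move=> [MS sSA sAE _ _ _ _ _ spE] eE.
rewrite /swapping_step /set_weight eE.
have [_ Mdown _] := mM.
have [eS|enS] := boolP (e \in cur st).
  have eA := subsetP sSA e eS.
  have -> : e |: cur st = cur st by apply/setUidPr; rewrite sub1set.
  have -> : e |: added st = added st by apply/setUidPr; rewrite sub1set.
  by rewrite MS; case: (st).
have nMeA : e |: heavy st (weight st e) \notin M.
  have := spE e eE; rewrite /spanned.
  by case/orP => // /(subsetP (heavy_sub _ _)); rewrite (negPf enS).
case: ifP => [MeS|_].
  by case/negP: nMeA; apply: Mdown MeS; apply/setUS/heavy_sub.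
case: ifP => // /andP[/tieM + ltse]; rewrite inE => /andP[+ _].
rewrite inE => /andP[sS MeSs]; case/negP: nMeA; apply: Mdown MeSs.
apply/setUS/subsetP => y; rewrite !inE => /andP[-> lewy]; rewrite andbT.
by apply/eqP => ys; move: ltse lewy; rewrite ys; lra.
Qed.

Lemma weight_set_weight st e x : e \notin seen st ->
  weight (set_weight f st e) x =
    if x == e then marginal f [set e] (added st) else weight st x.
Proof. by move=> enE; rewrite /set_weight (negPf enE) /= ffunE. Qed.

Lemma sum_weight_set_weight st e (C : {set V}) :
  e \notin seen st -> C \subset seen st ->
  \sum_(x in C) weight (set_weight f st e) x = \sum_(x in C) weight st x.
Proof.
move=> enE sCE; apply: eq_bigr => x xC; rewrite weight_set_weight //.
by case: eqP => // xe; move: enE; rewrite -xe (subsetP sCE).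
Qed.

(** Treats insertion ([S0] is [S]) and swap ([S0] is [S] without [s_e]) together. As [w(S')] grows
    by [w e], the gain hypothesis is what preserves [inv_added_weight]. *)
Lemma swapping_inv_insert st e (S0 : {set V}) :
    let w := weight (set_weight f st e) in
    let st' := State (e |: S0) (e |: added st) (e |: seen st) w in
    swapping_inv st -> e \notin seen st -> S0 \subset cur st -> e |: S0 \in M ->
    2 * \sum_(x in cur st) weight st x <= 2 * \sum_(x in S0) weight st x + w e ->
    (forall x, x \in seen st -> spanned M (heavy st' (weight st x)) x) ->
  swapping_inv st'.
Proof.
move=> w st' inv enE sS0S MS' le_gain spE'.
have [MS sSA sAE w0 margE valA subA lewA spE] := inv.
have we : w e = marginal f [set e] (added st).
  by rewrite /w weight_set_weight // eqxx.
have wE x : x \in seen st -> w x = weight st x.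
  move=> xE; rewrite /w weight_set_weight //; case: eqP => // xe.
  by rewrite xe (negPf enE) in xE.
have enA : e \notin added st by apply: contra enE; apply: (subsetP sAE).
have enS0 : e \notin S0.
  by apply: contra enA => /(subsetP sS0S)/(subsetP sSA).
have sumw (C : {set V}) : C \subset added st ->
    \sum_(x in C) w x = \sum_(x in C) weight st x.
  by move=> sCA; apply: sum_weight_set_weight => //; apply: subset_trans sAE.
have w0' x : x \in e |: seen st -> 0 <= w x.
  by case/setU1P => [->|xE]; [rewrite we; apply: fmono | rewrite wE ?w0].
split=> //=.
- by apply: setUS; apply: subset_trans sSA.
- exact: setUS.
- move=> x xE'; have [xA'|xnA'] := boolP (x \in e |: added st).
    by rewrite marginal_mem ?w0'.
  case/setU1P: xE' => [xe|xE]; first by rewrite xe setU11 in xnA'.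
  rewrite wE //; apply: le_trans (margE x xE).
  by apply: marginal_antimono => //; apply: subsetUr.
- by rewrite big_setU1 //= we sumw // -valA /marginal subrK.
- move=> C sCA'; have [eC|enC] := boolP (e \in C); last first.
    have sCA : C \subset added st.
      apply/subsetP => x xC; have /setU1P[xe|//] := subsetP sCA' x xC.
      by rewrite -xe xC in enC.
    by rewrite sumw // subA.
  have sCA : C :\ e \subset added st by rewrite subDset.
  rewrite (big_setD1 _ eC) /= sumw //.
  (* The weight of [e] is its marginal at all of [S'], hence at most its marginal at [C :\ e]. *)
  have := marginal_antimono e fmono fsub sCA.
  rewrite -we {1}/marginal setD1K // => lewe.
  by have := subA _ sCA; move: lewe; lra.
- rewrite !big_setU1 //= !sumw ?(subset_trans sS0S) //.
  by move: lewA le_gain; lra.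
- move=> x /setU1P[->|xE]; last by rewrite wE // spE'.
  by rewrite /spanned inE setU11 /=; have := w0' e (setU11 _ _); rewrite /w; lra.
Qed.

Lemma swapping_inv_step st e :
  swapping_inv st -> swapping_inv (swapping_step f M s st e).
Proof.
move=> inv; have [eE|enE] := boolP (e \in seen st).
  by rewrite swapping_step_seen.
have [MS sSA sAE w0 margE valA subA lewA spE] := inv.
rewrite /swapping_step; set st1 := set_weight f st e.
have st1E : st1 = State (cur st) (added st) (e |: seen st) (weight st1).
  by rewrite /st1 /set_weight (negPf enE).
have we : weight st1 e = marginal f [set e] (added st).
  by rewrite weight_set_weight // eqxx.
have w0e : 0 <= weight st1 e by rewrite we; apply: fmono.
have wE x : x \in seen st -> weight st1 x = weight st x.
  move=> xE; rewrite weight_set_weight //; case: eqP => // xe.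
  by rewrite xe (negPf enE) in xE.
have curE : cur st1 = cur st by rewrite st1E.
have addedE : added st1 = added st by rewrite st1E.
have seenE : seen st1 = e |: seen st by rewrite st1E.
have sSE : cur st \subset seen st by apply: subset_trans sAE.
have heavyE t : heavy st1 t = heavy st t.
  apply/setP => y; rewrite !inE curE; case: (boolP (y \in cur st)) => //= yS.
  by rewrite wE // (subsetP sSE).
rewrite curE addedE seenE; case: ifP => [MeS|/negbT nMeS].
  apply: swapping_inv_insert => //; first by rewrite lerDl.
  move=> x xE; apply: spannedS (spE x xE) => //.
  apply/subsetP => y /setIdP[yS lexy].
  by rewrite inE setU1r //= wE // (subsetP sSE).
have MS1 : cur st1 \in M by rewrite curE.
have nMeS1 : e |: cur st1 \notin M by rewrite curE.
case: ifP => [/andP[argN0 ltse]|noswap].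
  have := tieM _ _ argN0; rewrite inE => /andP[+ _]; rewrite inE curE.
  set y := s st1 e in ltse * => /andP[yS MeSy].
  have yE : y \in seen st := subsetP sSE y yS.
  have w0y := w0 y yE.
  rewrite (wE y yE) in ltse.
  apply: swapping_inv_insert => //; first exact: subD1set.
    by rewrite [X in 2 * X <= _](big_setD1 _ yS) /=; move: ltse; lra.
  move=> x xE; set st' := State _ _ _ _; set t := weight st x.
  (* If [2 * w y < t], then [y] was not heavy and no heavy element is lost. Otherwise [e] takes the
     place of [y], as [t <= 2 * w y < w e <= 2 * w e]. *)
  have [lety|ltyt] := leP t (2 * weight st y); last first.
    apply: spannedS (spE x xE) => //.
    apply/subsetP => z /setIdP[zS letz]; rewrite inE /= -/st1.
    rewrite wE ?(subsetP sSE) // letz andbT setU1r // !inE zS andbT.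
    by apply: contraTneq letz => ->; rewrite -ltNge.
  have enS : e \notin cur st by apply: contra enE; apply: (subsetP sSE).
  have heavy' : heavy st' t = e |: (heavy st t :\ y).
    apply/setP => z; rewrite !inE /= -/st1; have [->|nze] /= := eqVneq z e.
      by move: lety ltse w0y; lra.
    have [//|nzy] /= := eqVneq z y.
    case: (boolP (z \in cur st)) => //= zS.
    by rewrite wE // (subsetP sSE).
  have yH : y \in heavy st t by rewrite inE yS.
  rewrite heavy'; apply: spanned_trans (spE x xE) => //; first exact: heavy_indep.
    rewrite cardsU1 (cardsD1 y (heavy st t)) yH !inE.
    by rewrite (negPf enS) andbF.
  (* The old heavy set spans [e] since [y] is the lightest exchangeable element and
     [t <= 2 * w y]. *)
  move=> z /setU1P[->|/setD1P[_ zH]]; last by rewrite /spanned zH.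
  rewrite -heavyE; apply: heavy_spanned => // _.
  by rewrite -/y wE.
rewrite st1E; split=> //=.
- by apply: subset_trans sAE (subsetUr _ _).
- by move=> x /setU1P[->|xE] //; rewrite wE ?w0.
- by move=> x /setU1P[->|xE]; rewrite ?we // wE ?margE.
- by rewrite sum_weight_set_weight.
- move=> C sCA; rewrite sum_weight_set_weight ?subA //.
  exact: subset_trans sAE.
- by rewrite !sum_weight_set_weight.
(* For a rejected [e] with a possible exchange, the failed test reads [w e <= 2 * w s_e]. *)
- move=> x /setU1P[->|xE]; rewrite -st1E.
    apply: heavy_spanned => // argN0.
    by move: noswap; rewrite argN0 /= => /negbT; rewrite -leNgt.
  by rewrite heavyE wE ?spE.
Qed.

Lemma seen_swapping_step st e :
  seen (swapping_step f M s st e) = e |: seen st.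
Proof.
have seen1 : seen (set_weight f st e) = e |: seen st.
  rewrite /set_weight; case: ifP => //= eE.
  by apply/esym/setUidPr; rewrite sub1set.
by rewrite /swapping_step; do 2!case: ifP => _ //=.
Qed.

Lemma swapping_inv_run (adv : adaptive_stream R V) n :
  let h := swapping f M s adv n in
  swapping_inv (final_state h) /\ seen (final_state h) = arrived h.
Proof.
elim: n => [|n [inv seenE]] /=.
  split; first exact: swapping_inv_init.
  by apply/setP => x; rewrite !inE.
case: (adv _) => [e|//]; rewrite /final_state /unzip2 map_rcons last_rcons.
split; first exact: swapping_inv_step.
rewrite seen_swapping_step seenE; apply/setP => x.
by rewrite !inE /unzip1 map_rcons mem_rcons inE.
Qed.

Lemma swapping_inv_bound st (O : {set V}) : swapping_inv st ->
  O \in M -> O \subset seen st -> f O <= 4 * f (cur st).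
Proof.
move=> [MS sSA sAE w0 margE valA subA lewA spE] MO sOE.
have wO : \sum_(x in O) weight st x <= \sum_(y in cur st) 2 * weight st y.
  apply: ler_sum_of_card_superlevel => [y yS|t].
    by rewrite mulr_ge0 // w0 // (subsetP sAE) // (subsetP sSA).
  have [_ Mdown _] := mM.
  apply: (card_spanned mM); first exact: (heavy_indep st t MS).
    by apply: Mdown MO; apply/subsetP => x /setIdP[].
  move=> x /setIdP[xO letx].
  (* The heavy set shrinks as the threshold grows, so [t <= w x] lets the set at [w x] be replaced
     by the one at [t]. *)
  apply: spannedS (spE x (subsetP sOE x xO)) => //.
  apply/subsetP => y /setIdP[yS lexy]; rewrite inE yS /=.
  exact: le_trans lexy.
rewrite -mulr_sumr in wO.
have fO : f O <= f (O :|: added st).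
  by apply: monotone_subset => //; apply: subsetUl.
have fOA := submodular_setU_le O (added st) fmono fsub.
have margO : \sum_(x in O) marginal f [set x] (added st)
             <= \sum_(x in O) weight st x.
  by apply: ler_sum => x xO; apply: margE; apply: (subsetP sOE).
by have := subA _ sSA; move: wO fO fOA margO lewA; rewrite -valA; lra.
Qed.

End Swapping.

Theorem theorem1 (R : realFieldType) (V : finType)
    (f : {set V} -> R) (M : {set {set V}})
    (s : state R V -> V -> V) (adv : adaptive_stream R V) (n : nat) :
  nonnegative f -> monotone f -> normalized f -> submodular f ->
  matroid M ->
  tie_breaking M s ->
  let h := swapping f M s adv n in
  let S := cur (final_state h) in
  S \in M /\
  forall O : {set V}, max_independent f M (arrived h) O -> f O <= 4 * f S.
Proof.
move=> _ fmono fnorm fsub mM tieM h S.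
have [inv seenE] := swapping_inv_run fmono fnorm fsub mM tieM adv n.
split=> [|O [MO sO _]]; first exact: inv_indep inv.
by apply: (swapping_inv_bound fmono fsub mM inv MO); rewrite seenE.
Qed.
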